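(* For any $G$-graded $R$-module $M$, the set $S=\{S_r : r\in h(R)\}$ forms a base for the Zariski topology on $\mathcal{PS}_G(M)$, where $S_r=\mathcal{PS}_G(M)-\nu_G(rM)$ for each $r\in h(R)$.
   Context: $G$ is a multiplicative group, $R=\bigoplus_{g\in G}R_g$ is a commutative $G$-graded ring with identity ($R_gR_h\subseteq R_{gh}$), and $M=\bigoplus_{g\in G}M_g$ is a $G$-graded $R$-module ($R_gM_h\subseteq M_{gh}$). $h(R)=\bigcup_g R_g$ and $h(M)=\bigcup_g M_g$ are the sets of homogeneous elements. An ideal $I$ is graded if $I=\bigoplus_g(I\cap R_g)$; a submodule $N$ is graded if $N=\bigoplus_g(N\cap M_g)$. For a graded submodule $N$, $(N:_R M)=\{r\in R: rM\subseteq N\}$, a graded ideal of $R$. For a graded ideal $I$, the graded radical $Gr(I)$ is the set of all $a=\sum_g a_g\in R$ such that for each $g$ there is $n_g>0$ with $a_g^{n_g}\in I$. A proper graded submodule $P$ of $M$ is graded prime if for $r\in h(R)$, $m\in h(M)$, $rm\in P$ implies $m\in P$ or $r\in(P:_R M)$. $Spec_G(M)$ is the set of graded prime submodules of $M$. A proper graded submodule $Q$ is graded primary if for $r\in h(R)$, $m\in h(M)$, $rm\in Q$ implies $m\in Q$ or $r\in Gr((Q:_R M))$. For a graded submodule $N$, $Gr_M(N)$ is the intersection of all graded prime submodules of $M$ containing $N$, with $Gr_M(N)=M$ if there are none. The graded primary spectrum $\mathcal{PS}_G(M)$ is the set of all graded primary submodules $Q$ of $M$ with $(Gr_M(Q):_R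 M)=Gr((Q:_R M))$. For a graded submodule $N$ of $M$, $\nu_G(N)=\{Q\in\mathcal{PS}_G(M): (N:_R M)\subseteq(Gr_M(Q):_R M)\}$. The Zariski topology on $\mathcal{PS}_G(M)$ is the topology whose closed sets are exactly the sets $\nu_G(N)$, $N$ a graded submodule of $M$. Standing assumption: $Spec_G(M)$ and $\mathcal{PS}_G(M)$ are non-empty. *)

(* Defs.v *)
From HB Require Import structures.
From mathcomp Require Import all_boot all_order all_algebra.
From mathcomp Require Import all_classical topology.

Set Implicit Arguments.
Unset Strict Implicit.
Unset Printing Implicit Defensive.

Import GRing.Theory.
Local Open Scope classical_set_scope.
Local Open Scope ring_scope.

Section DirectSum.
Context {G : choiceType} {V : zmodType}.
Implicit Types (A : G -> set V) (B : set V) (c : G -> V) (x : V).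

(* [\sum_(g \in setT) c g] is the library's finitely supported sum, which is
   [0] by convention when the support of [c] is infinite: hence the explicit
   finiteness condition. *)
Definition decomposition A x c :=
  [/\ forall g, A g (c g), finite_set (c @^-1` [set~ 0])
    & x = \sum_(g \in setT) c g].

(* B is the internal direct sum of the subgroups A g. *)
Definition direct_sum A B :=
  [/\ forall g, zmod_closed [in A g],
      forall x, B x <-> exists c, decomposition A x c
    & forall x c c', decomposition A x c -> decomposition A x c' -> c = c'].

End DirectSum.

Record grading (G : groupType) (V : zmodType) := Grading {
  gcomp :> G -> set V;
  gcomp_direct : direct_sum gcomp [set: V] }.

Record gradedRing (G : groupType) (R : comPzRingType) := GradedRing {
  ring_grading :> grading G R;
  gradedM : forall g h x y, ring_grading g x -> ring_grading h y ->
    ring_grading (g * h)%g (x * y) }.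

Record gradedModule (G : groupType) (R : comPzRingType)
    (gR : gradedRing G R) (M : lmodType R) := GradedModule {
  module_grading :> grading G M;
  gradedZ : forall g h r m, gR g r -> module_grading h m ->
    module_grading (g * h)%g (r *: m) }.

Definition homogeneous (G : groupType) (V : zmodType) (gV : grading G V) :
  set V := \bigcup_g gV g.

Definition graded_radical (G : groupType) (R : comPzRingType)
    (gR : gradedRing G R) (I : set R) : set R :=
  [set a | exists c, decomposition gR a c /\
    forall g, exists2 n, (0 < n)%N & I (c g ^+ n)].

Section GradedPrimary.
Context {G : groupType} {R : comPzRingType} {gR : gradedRing G R}
        {M : lmodType R} (gM : gradedModule gR M).
Implicit Types (N P Q : set M) (I : set R) (r : R) (m : M).

Definition graded_submodule N :=
  submod_closed [in N] /\ direct_sum (fun g => N `&` gM g) N.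

(* (N :_R M) *)
Definition colon N : set R := [set r | forall m, N (r *: m)].

Definition graded_prime P :=
  [/\ graded_submodule P, P <> setT &
      forall r m, homogeneous gR r -> homogeneous gM m ->
        P (r *: m) -> P m \/ colon P r].

Definition graded_spectrum : set (set M) := [set P | graded_prime P].

Definition graded_primary Q :=
  [/\ graded_submodule Q, Q <> setT &
      forall r m, homogeneous gR r -> homogeneous gM m ->
        Q (r *: m) -> Q m \/ graded_radical gR (colon Q) r].

(* Gr_M(N); the intersection of the empty family is all of M. *)
Definition graded_module_radical N : set M :=
  \bigcap_(P in [set P | graded_spectrum P /\ N `<=` P]) P.

Definition graded_primary_spectrum : set (set M) :=
  [set Q | graded_primary Q /\
    colon (graded_module_radical Q) = graded_radical gR (colon Q)].

(* The same set, as the carrier of the Zariski topology. *)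
Definition PSG : Type := set_type graded_primary_spectrum.

HB.instance Definition _ := Choice.copy PSG (set_type graded_primary_spectrum).

Definition variety N : set PSG :=
  [set Q | colon N `<=` colon (graded_module_radical (val Q))].

Definition zariski_closed : set (set PSG) :=
  [set F | exists2 N, graded_submodule N & F = variety N].

(* rM *)
Definition scaled_module r : set M := range (fun m => r *: m).

Definition basic_open r : set PSG := setT `\` variety (scaled_module r).

End GradedPrimary.

Arguments variety {G R gR M} gM N _.
Arguments zariski_closed {G R gR M} gM _.
Arguments basic_open {G R gR M} gM r _.

Section Decomposition.
Context {G : choiceType} {V : zmodType}.
Implicit Types (A : G -> set V) (c : G -> V) (x : V).

Lemma decomposition_single A g x :
  (forall h, A h 0) -> A g x ->
  decomposition A x (fun h => if h == g then x else 0).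
Proof.
move=> A0 Agx.
have sub : (fun h => if h == g then x else 0) @^-1` [set~ 0] `<=` [set g].
  by move=> h /=; case: eqP.
split.
- by move=> h; case: eqP => [->|].
- exact: sub_finite_set sub (finite_set1 g).
- rewrite -(fsbig_widen [set g]) //; first by rewrite fsbig_set1 eqxx.
  by move=> h [_ /=]; case: eqP.
Qed.

Lemma decomposition_ind A (N : set V) x c :
  N 0 -> (forall u v, N u -> N v -> N (u + v)) ->
  decomposition A x c -> (forall g, N (c g)) -> N x.
Proof. by move=> N0 ND [_ _ ->] Nc; apply: (big_ind N). Qed.

End Decomposition.

Section GradedTheory.
Context {G : groupType} {V : zmodType} (gV : grading G V).
Implicit Types (x : V) (g : G).

Lemma grading0 g : gV g 0.
Proof. by have [/(_ g) [+ _] _ _] := gcomp_direct gV; rewrite inE. Qed.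

Lemma grading_ex x : exists c, decomposition gV x c.
Proof. by have [_ + _] := gcomp_direct gV => /(_ x) [+ _]; apply. Qed.

Lemma grading_uniq x c c' :
  decomposition gV x c -> decomposition gV x c' -> c = c'.
Proof. by have [_ _] := gcomp_direct gV; apply. Qed.

Lemma decomposition_homogeneous g x c : gV g x -> decomposition gV x c ->
  c = fun h => if h == g then x else 0.
Proof.
by move=> gx /grading_uniq; apply; apply: decomposition_single => // h; exact: grading0.
Qed.

End GradedTheory.

(* An additive map sending the component of degree h into that of degree f h,
   with f injective, commutes with taking components. *)
Lemma decomposition_map (G : groupType) (V W : zmodType) (gV : grading G V)
    (gW : grading G W) (phi : V -> W) (f f' : G -> G) x c :
  (forall u v, phi (u + v) = phi u + phi v) -> phi 0 = 0 ->
  cancel f f' -> cancel f' f ->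
  (forall g u, gV g u -> gW (f g) (phi u)) ->
  decomposition gV x c -> decomposition gW (phi x) (fun g => phi (c (f' g))).
Proof.
move=> phiD phi0 fK f'K phih [cA cf ->].
have bf : set_bij setT setT f.
  by split=> // [u v _ _ /(can_inj fK)|u _] //; exists (f' u).
split.
- by move=> g; rewrite -{1}(f'K g); apply: phih.
- apply: (sub_finite_set _ (finite_image f cf)) => g /= pg.
  by exists (f' g); rewrite ?f'K // => c0; apply: pg; rewrite c0.
- have -> : \sum_(g \in setT) phi (c (f' g)) = \sum_(g \in setT) phi (c g).
    by rewrite (reindex_fsbig f setT setT) //; apply: eq_fsbigr => g _; rewrite fK.
  rewrite -(fsbig_widen (c @^-1` [set~ 0]) setT c) //; last first.
    by move=> g [_ /=] /contrapT.
  rewrite -[RHS](fsbig_widen (c @^-1` [set~ 0]) setT) //; last first.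
    by move=> g [_ /=] /contrapT ->.
  by rewrite !fsbig_finite // (big_morph phi phiD phi0).
Qed.

Section Zariski.
Context {G : groupType} {R : comPzRingType} {gR : gradedRing G R}
        {M : lmodType R} (gM : gradedModule gR M).
Implicit Types (N P Q : set M) (I : set R) (r a b : R) (m : M).

Lemma graded_submodule0 N : graded_submodule gM N -> N 0.
Proof. by case=> -[+ _] _; rewrite inE. Qed.

Lemma graded_submoduleZD N a u v :
  graded_submodule gM N -> N u -> N v -> N (a *: u + v).
Proof. by case=> -[_ /(_ a u v)] + _; rewrite !inE; apply. Qed.

Lemma graded_submoduleD N u v : graded_submodule gM N -> N u -> N v -> N (u + v).
Proof. by move=> gN Nu Nv; rewrite -[u]scale1r; apply: graded_submoduleZD. Qed.

Lemma graded_submoduleZ N a u : graded_submodule gM N -> N u -> N (a *: u).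
Proof.
move=> gN Nu; rewrite -[_ *: _]addr0; apply: graded_submoduleZD => //.
exact: graded_submodule0.
Qed.

Lemma graded_submodule_comp N u c g :
  graded_submodule gM N -> N u -> decomposition gM u c -> N (c g).
Proof.
move=> [_ [_ /(_ u) [+ _] _]] Nu dc => /(_ Nu) [c' [c'N fc' uc']].
have /(grading_uniq dc) -> : decomposition gM u c'.
  by split=> // h; have [] := c'N h.
by have [] := c'N g.
Qed.

Lemma graded_submoduleI N :
  N 0 -> (forall a u v, N u -> N v -> N (a *: u + v)) ->
  (forall u c g, N u -> decomposition gM u c -> N (c g)) ->
  graded_submodule gM N.
Proof.
move=> N0 NZ Nc; split; first by split=> [|a u v]; rewrite !inE //; apply: NZ.
have ND u v : N u -> N v -> N (u + v) by rewrite -{2}[u]scale1r; apply: NZ.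
split.
- move=> g; have [/(_ g) [_ gB] _ _] := gcomp_direct gM.
  split=> [|u v]; rewrite !inE; first by split=> //; exact: grading0.
  move=> [Nu gu] [Nv gv]; split; first by rewrite addrC -scaleN1r; apply: NZ.
  by have := gB u v; rewrite !inE; apply.
- move=> u; split=> [Nu|[c dc]]; last first.
    by apply: (decomposition_ind _ _ dc) => // g; case: dc => /(_ g) [].
  have [c dc] := grading_ex gM u; exists c; case: (dc) => cA cf uc.
  by split=> // g; split=> //; exact: Nc Nu dc.
- move=> u c c' [cA cf uc] [cA' cf' uc'].
  by apply: (@grading_uniq _ _ gM u); split=> // g; [have [] := cA g|have [] := cA' g].
Qed.

Lemma graded_submodule_bigcap (F : set (set M)) :
  F `<=` graded_submodule gM -> graded_submodule gM (\bigcap_(N in F) N).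
Proof.
move=> FG; apply: graded_submoduleI.
- by move=> N /FG/graded_submodule0.
- by move=> a u v Nu Nv N FN; apply: graded_submoduleZD; [exact: FG|exact: Nu|exact: Nv].
- move=> u c g Nu dc N FN; apply: graded_submodule_comp dc; first exact: FG.
  exact: Nu.
Qed.

Lemma graded_module_radical_graded N :
  graded_submodule gM (graded_module_radical gM N).
Proof. by apply: graded_submodule_bigcap => P [[]]. Qed.

Lemma colon0 N : graded_submodule gM N -> colon N 0.
Proof. by move=> gN m; rewrite scale0r; exact: graded_submodule0. Qed.

Lemma colonD N a b : graded_submodule gM N ->
  colon N a -> colon N b -> colon N (a + b).
Proof. by move=> gN Na Nb m; rewrite scalerDl; exact: graded_submoduleD. Qed.

Lemma colon_comp N a c g : graded_submodule gM N ->
  colon N a -> decomposition gR a c -> colon N (c g).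
Proof.
move=> gN Na dc m; have [d dm] := grading_ex gM m.
apply: (@decomposition_ind _ _ gM (fun x => N (c g *: x)) m d) => //.
- by rewrite scaler0; exact: graded_submodule0.
- by move=> u v; rewrite scalerDr; exact: graded_submoduleD.
move=> h.
have dd : decomposition gM (a *: d h) (fun k => c (k * h^-1)%g *: d h).
  apply: (@decomposition_map _ _ _ gR gM (fun r => r *: d h)
    (fun g => g * h)%g (fun g => g * h^-1)%g) => //.
  - by move=> u v; rewrite scalerDl.
  - by rewrite scale0r.
  - by move=> k; rewrite mulgK.
  - by move=> k; rewrite mulgVK.
  - by move=> k u ku; apply: gradedZ => //; case: dm.
by have := graded_submodule_comp (g * h)%g gN (Na _) dd; rewrite mulgK.
Qed.

Lemma colon_sub N N' : N `<=` N' -> colon N `<=` colon N'.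
Proof. by move=> NN' r Nr m; apply: NN'. Qed.

Lemma grading1 : gR 1%g 1.
Proof.
have [e de] := grading_ex gR 1; case: (de) => eA _ e1.
suff e1E x : x * e 1%g = x by rewrite -[1](e1E 1) mul1r.
have [c dc] := grading_ex gR x.
apply: (@decomposition_ind _ _ gR (fun x => x * e 1%g = x) x c) => //.
- by rewrite mul0r.
- by move=> u v uE vE; rewrite mulrDl uE vE.
move=> h; case: dc => /(_ h) hc _ _.
have dd : decomposition gR (c h * 1) (fun k => c h * e (h^-1 * k)%g).
  apply: (@decomposition_map _ _ _ gR gR (fun x => c h * x)
    (fun k => h * k)%g (fun k => h^-1 * k)%g) => //.
  - by move=> u v; rewrite mulrDr.
  - by rewrite mulr0.
  - by move=> k; rewrite mulKg.
  - by move=> k; rewrite mulVKg.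
  - by move=> k u ku; apply: gradedM.
rewrite mulr1 in dd.
have /(congr1 (fun f => f h)) /= := decomposition_homogeneous hc dd.
by rewrite eqxx mulVg.
Qed.

Lemma homogeneousX a n : homogeneous gR a -> homogeneous gR (a ^+ n).
Proof.
move=> [g _ ga]; elim: n => [|n [h _ hn]]; first by exists 1%g => //; exact: grading1.
by exists (g * h)%g => //; rewrite exprS; apply: gradedM.
Qed.

Lemma homogeneousM a b :
  homogeneous gR a -> homogeneous gR b -> homogeneous gR (a * b).
Proof. by move=> [g _ ga] [h _ hb]; exists (g * h)%g => //; exact: gradedM. Qed.

Lemma graded_radicalP I a : I 0 -> homogeneous gR a ->
  graded_radical gR I a <-> exists2 n, (0 < n)%N & I (a ^+ n).
Proof.
move=> I0 [g _ ga]; split=> [[c [dc /(_ g)]]|[n n0 In]].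
  by rewrite (decomposition_homogeneous ga dc) eqxx.
exists (fun h => if h == g then a else 0); split.
  by apply: decomposition_single => // h; exact: grading0.
by move=> h; case: eqP => _; [exists n|exists 1%N; rewrite ?expr1].
Qed.

Lemma graded_primary_radicalM Q a b :
  graded_primary gM Q -> homogeneous gR a -> homogeneous gR b ->
  graded_radical gR (colon Q) (a * b) ->
  graded_radical gR (colon Q) a \/ graded_radical gR (colon Q) b.
Proof.
move=> [gQ _ Qp] ha hb; have Q0 := colon0 gQ.
move=> /(graded_radicalP Q0 (homogeneousM ha hb)) [n n0].
rewrite exprMn => Qab.
have [Qb|/existsNP [m Qbm]] := pselect (colon Q (b ^+ n)).
  by right; apply/(graded_radicalP Q0 hb); exists n.
left; have [d dm] := grading_ex gM m.
have [h Qbh] : exists h, ~ Q (b ^+ n *: d h).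
  apply: contra_notP Qbm => /forallNP Qd.
  apply: (@decomposition_ind _ _ gM (fun x => Q (b ^+ n *: x)) m d) => //.
  - by rewrite scaler0; exact: graded_submodule0.
  - by move=> u v; rewrite scalerDr; exact: graded_submoduleD.
  - by move=> h; exact: contrapT.
have hd : homogeneous gM (b ^+ n *: d h).
  have [k _ kb] := homogeneousX n hb; exists (k * h)%g => //.
  by apply: gradedZ => //; case: dm.
have [] := Qp _ _ (homogeneousX n ha) hd; first by rewrite scalerA; exact: Qab.
  by [].
move=> /(graded_radicalP Q0 (homogeneousX n ha)) [k k0].
rewrite -exprM => Qa; apply/(graded_radicalP Q0 ha).
by exists (n * k)%N => //; rewrite muln_gt0 n0.
Qed.

Lemma PSG_primary (Q : PSG gM) : graded_primary gM (val Q).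
Proof. by have := valP Q; rewrite inE => -[]. Qed.

Lemma PSG_radical (Q : PSG gM) :
  colon (graded_module_radical gM (val Q)) = graded_radical gR (colon (val Q)).
Proof. by have := valP Q; rewrite inE => -[]. Qed.

Lemma variety_setI N N' : graded_submodule gM N -> graded_submodule gM N' ->
  variety gM N `|` variety gM N' = variety gM (N `&` N').
Proof.
move=> gN gN'; apply/seteqP; split=> Q.
  by case; apply: subset_trans; apply: colon_sub => x [].
move=> QNN'; apply: contrapT => /not_orP[].
move=> /existsNP [a /not_implyP [Na Qa]] /existsNP [b /not_implyP [Nb Qb]].
pose p := colon (graded_module_radical gM (val Q)).
have gp := graded_module_radical_graded (val Q).
have comp N0 x : graded_submodule gM N0 -> colon N0 x -> ~ p x ->
    exists2 y, homogeneous gR y & colon N0 y /\ ~ p y.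
  move=> gN0 N0x px; have [c dc] := grading_ex gR x.
  have [g pg] : exists g, ~ p (c g).
    apply: contra_notP px => /forallNP pc.
    apply: (decomposition_ind _ _ dc) => [|u v|g]; last exact: contrapT.
    - exact: colon0.
    - exact: colonD.
  exists (c g); first by exists g => //; case: dc.
  by split=> //; exact: colon_comp dc.
have {Na Qa}[{}a ha [Na pa]] := comp _ _ gN Na Qa.
have {Nb Qb}[{}b hb [Nb pb]] := comp _ _ gN' Nb Qb.
have : p (a * b).
  apply: QNN' => m; split; first by rewrite -scalerA; exact: Na.
  by rewrite mulrC -scalerA; exact: Nb.
move: pa pb; rewrite /p PSG_radical => pa pb.
by case/(graded_primary_radicalM (PSG_primary Q) ha hb).
Qed.

Lemma variety_bigcap (K : Type) (N : K -> set M) :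
  exists2 N', graded_submodule gM N' & variety gM N' = \bigcap_i variety gM (N i).
Proof.
pose F := [set P | graded_submodule gM P /\ forall i, colon (N i) `<=` colon P].
exists (\bigcap_(P in F) P); first by apply: graded_submodule_bigcap => P [].
apply/seteqP; split=> Q NQ.
  move=> i _ r Nr; apply: NQ => m P [_ /(_ i)]; exact.
apply: colon_sub => x; apply; split; first exact: graded_module_radical_graded.
by move=> i; exact: NQ.
Qed.

Lemma graded_submoduleT : graded_submodule gM setT.
Proof. exact: graded_submoduleI. Qed.

Lemma varietyT : variety gM setT = set0.
Proof.
apply/seteqP; split=> // Q /(_ 1) => /(_ (fun _ => I)).
have [gQ QT _] := PSG_primary Q.
rewrite PSG_radical => /(graded_radicalP (colon0 gQ)).
case; first by exists 1%g => //; exact: grading1.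
move=> n _; rewrite expr1n => Q1; apply: QT.
by apply/seteqP; split=> // m _; rewrite -[m]scale1r; exact: Q1.
Qed.

Let zariski_open : set_system (PSG gM) := [set U | zariski_closed gM (~` U)].

Let zariski_openT : zariski_open setT.
Proof.
by exists setT; [exact: graded_submoduleT|rewrite varietyT setCT].
Qed.

Let zariski_openI : setI_closed zariski_open.
Proof.
move=> U V [N gN UN] [N' gN' VN']; exists (N `&` N').
  rewrite -bigcap2inE; have -> : \bigcap_(i < 2) bigcap2 N N' i =
      \bigcap_(P in [set N; N']) P.
    apply/seteqP; split=> x xN.
      by move=> P [] ->; [exact: (xN 0%N)|exact: (xN 1%N)].
    by move=> [|[|]] //= _; apply: xN; [left|right].
  by apply: graded_submodule_bigcap => P [] ->.
by rewrite -variety_setI // setCI UN VN'.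
Qed.

Let zariski_open_bigU (K : Type) (f : K -> set (PSG gM)) :
  (forall i, zariski_open (f i)) -> zariski_open (\bigcup_i f i).
Proof.
move=> fo; pose N i := sval (cid2 (fo i)).
have [N' gN' NE] := variety_bigcap N; exists N' => //.
rewrite setC_bigcup NE; apply: eq_bigcapr => i _.
by rewrite /N; case: cid2.
Qed.

HB.instance Definition _ := isOpenTopological.Build (PSG gM)
  zariski_openT zariski_openI zariski_open_bigU.

Lemma closed_PSGE : @closed (PSG gM) = zariski_closed gM.
Proof.
apply/funext => F; rewrite -openC -[in RHS](setCK F).
by [].
Qed.

End Zariski.

(* Main.v *)
(** The complement of the basic open set of a homogeneous [r] is the variety of
    [rM], a graded submodule.  If [Q] lies outside the variety of [N], then
    [(N : M)] is not contained in [(Gr_M(Q) : M)]; as both ideals are graded,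
    some homogeneous [r] in the first is not in the second.  The basic open set
    of [r] contains [Q], and it misses the variety of [N] because [rM] is
    contained in [N]. *)

Require Import Defs.
From HB Require Import structures.
From mathcomp Require Import all_boot all_order all_algebra.
From mathcomp Require Import all_classical topology.

Import GRing.Theory.
Local Open Scope classical_set_scope.
Local Open Scope ring_scope.

Section BasicOpens.
Context {G : groupType} {R : comPzRingType} {gR : gradedRing G R}
        {M : lmodType R} (gM : gradedModule gR M).

(** Multiplication by [r] of degree [g] sends degree [k] to degree [g * k], so by uniqueness each
    component of [r *: m] is again a multiple of [r]. *)
Lemma graded_scaled_module (r : R) :
  homogeneous gR r -> graded_submodule gM (scaled_module r).
Proof.
move=> [g _ gr]; apply: graded_submoduleI.
- by exists 0; rewrite ?scaler0.
- move=> a _ _ [m _ <-] [m' _ <-]; exists (a *: m + m') => //.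
  by rewrite scalerDr !scalerA mulrC.
- move=> _ c h [m _ <-] dc; have [d dm] := grading_ex gM m.
  have drm : decomposition gM (r *: m) (fun k => r *: d (g^-1 * k)%g).
    apply: (@decomposition_map _ _ _ gM gM (fun x => r *: x)
      (fun k => g * k)%g (fun k => g^-1 * k)%g) => //.
    + by move=> u v; rewrite scalerDr.
    + by rewrite scaler0.
    + by move=> k; rewrite mulKg.
    + by move=> k; rewrite mulVKg.
    + by move=> k u ku; apply: gradedZ.
  by rewrite (grading_uniq dc drm); exists (d (g^-1 * h)%g).
Qed.

Lemma open_basic_open (r : R) : homogeneous gR r -> open (basic_open gM r).
Proof.
move=> hr; rewrite /basic_open setTD openC closed_PSGE.
by exists (scaled_module r) => //; exact: graded_scaled_module.
Qed.

(** Since [colon P] is closed under sums, an element outside it has a component outside it; that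
    component stays in the graded ideal [colon N]. *)
Lemma colon_homogeneousN (N P : set M) :
  graded_submodule gM N -> graded_submodule gM P -> ~ colon N `<=` colon P ->
  exists2 r, homogeneous gR r & colon N r /\ ~ colon P r.
Proof.
move=> gN gP /existsNP [a /not_implyP [Na Pa]].
have [c dc] := grading_ex gR a.
have [g Pg] : exists g, ~ colon P (c g).
  apply: contra_notP Pa => /forallNP Pc.
  apply: (decomposition_ind _ _ dc) => [|u v|g]; last exact: contrapT.
  - exact: colon0 gP.
  - exact: colonD gP.
exists (c g); first by exists g => //; case: dc.
by split=> //; exact: colon_comp gN Na dc.
Qed.

(** The scalar [r] itself lies in [colon (scaled_module r)]. *)
Lemma basic_open_mem (r : R) (Q : PSG gM) :
  ~ colon (graded_module_radical gM (val Q)) r -> basic_open gM r Q.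
Proof. by move=> Qr; split=> // /(_ r) rQ; apply: Qr; apply: rQ => m; exists m. Qed.

Lemma variety_scaled_module (N : set M) (r : R) :
  colon N r -> variety gM N `<=` variety gM (scaled_module r).
Proof.
by move=> Nr Q; apply: subset_trans; apply: colon_sub => _ [m _ <-]; exact: Nr.
Qed.

End BasicOpens.

Local Close Scope ring_scope.

Theorem proposition3p1 (G : groupType) (R : comPzRingType)
    (gR : gradedRing G R) (M : lmodType R) (gM : gradedModule gR M) :
  graded_spectrum gM !=set0 ->
  graded_primary_spectrum gM !=set0 ->
  basis [set basic_open gM r | r in homogeneous gR].
Proof.
move=> _ _; split=> [_ [r hr <-]|Q U]; first exact: open_basic_open.
rewrite nbhsE => -[V [Vo VQ] VU].
move: (Vo); rewrite -closedC closed_PSGE => -[N gN VN].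
have [|r hr [Nr Qr]] := colon_homogeneousN _ _ _ gN
    (graded_module_radical_graded gM (val Q)).
  by move=> NQ; have : (~` V) Q by rewrite VN.
exists (basic_open gM r).
  by split; [exists r|exact: basic_open_mem].
(* Outside [V], the point [Q'] would lie in the variety of [N], hence in that of [rM]. *)
move=> Q' [_ rQ']; apply: VU; apply: contrapT => VQ'.
apply: rQ'; apply: (variety_scaled_module _ _ _ Nr).
by rewrite -VN.
Qed.
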